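(* For every $d\in\mathbb{N}$ there exist a multiple mixing system $(X,\mathcal{X},\mu,T)$ and a set $A\in\mathcal{X}$ with $0<\mu(A)<1$ such that for every $\ell\in\{1,\ldots,d\}$ we have $$\mu(A\cap T^{-n_1}A\cap\cdots\cap T^{-n_\ell}A)<\mu(A)^{\ell+1}$$ for all distinct $n_1,\ldots,n_\ell\in\mathbb{N}$. A similar result also holds with the strict inequality reversed: for every $d\in\mathbb{N}$ there exist a multiple mixing system $(X,\mathcal{X},\mu,T)$ and a set $A\in\mathcal{X}$ with $0<\mu(A)<1$ such that for every $\ell\in\{1,\ldots,d\}$ we have $$\mu(A\cap T^{-n_1}A\cap\cdots\cap T^{-n_\ell}A)>\mu(A)^{\ell+1}$$ for all distinct $n_1,\ldots,n_\ell\in\mathbb{N}$.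
   Context: A measure preserving system (or system) is a quadruple $(X,\mathcal{X},\mu,T)$ where $(X,\mathcal{X},\mu)$ is a probability space and $T\colon X\to X$ is a measure preserving transformation. $\mathbb{N}=\{1,2,\ldots\}$. All functions are real valued and $T^nf$ denotes $f\circ T^n$. A system $(X,\mathcal{X},\mu,T)$ is multiple mixing if for every $\ell\in\mathbb{N}$ and all $f_0,f_1,\ldots,f_\ell\in L^\infty(\mu)$ one has $$\lim_{n_1,\ldots,n_\ell}\int f_0\cdot T^{n_1}f_1\cdots T^{n_\ell}f_\ell\,d\mu=\prod_{i=0}^{\ell}\int f_i\,d\mu,$$ where the limit is taken as $\min\{n_1,n_2-n_1,\ldots,n_\ell-n_{\ell-1}\}\to\infty$. *)

(* Defs.v *)
From HB Require Import structures.
From mathcomp Require Import all_boot all_order all_algebra.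
From mathcomp Require Import all_classical all_reals all_analysis.

Set Implicit Arguments.
Unset Strict Implicit.
Unset Printing Implicit Defensive.
Import Order.TTheory GRing.Theory Num.Theory.
Import numFieldNormedType.Exports.
Local Open Scope classical_set_scope.
Local Open Scope ring_scope.

Definition measure_preserving (R : realType) (disp : measure_display)
    (X : measurableType disp) (mu : probability X R) (T : X -> X) : Prop :=
  measurable_fun setT T /\
  forall B : set X, measurable B -> mu (T @^-1` B) = mu B.

(* The filter min {n_1, n_2 - n_1, ..., n_l - n_(l-1)} --> oo on l-tuples of
   times: [path r 0 n] tests [r 0 n_1], [r n_1 n_2], ..., [r n_(l-1) n_l], and
   [a + N <= b] is [N <= b - a] without the truncation of subtraction on nat. *)
Definition gaps_to_infty (l : nat) : set_system (l.-tuple nat) :=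
  filter_from setT
    (fun N : nat => [set n : l.-tuple nat | path (fun a b => a + N <= b)%N 0%N n]).
Arguments gaps_to_infty : clear implicits.

#[global] Instance gaps_to_infty_filter (l : nat) :
  ProperFilter (gaps_to_infty l).
Proof.
apply: filter_from_proper.
  apply: filter_fromT_filter; first by exists 0%N.
  move=> M N; exists (maxn M N) => n /= hn; split.
    by apply: sub_path hn => a b; apply: leq_trans; rewrite leq_add2l leq_maxl.
  by apply: sub_path hn => a b; apply: leq_trans; rewrite leq_add2l leq_maxr.
move=> N _; exists (mktuple (fun i : 'I_l => i.+1 * N)%N) => /=.
rewrite (_ : map _ _ = map (fun k => k.+1 * N)%N (iota 0 l)); last first.
  by rewrite -val_enum_ord -map_comp.
rewrite -[X in path _ X _](mul0n N); elim: l 0%N => [|l IHl] k //.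
apply/andP; split; last exact: IHl.
by rewrite mulSn addnC.
Qed.

(* Both sides are real numbers: [\int[mu]_x _] in ring_scope is [Rintegral], and
   if [T] preserves [mu], every integrand is essentially bounded, so integrable. *)
Definition multiple_mixing (R : realType) (disp : measure_display)
    (X : measurableType disp) (mu : probability X R) (T : X -> X) : Prop :=
  forall (l : nat) (f0 : X -> R) (f : 'I_l -> X -> R), (1 <= l)%N ->
    f0 \in Lfun mu +oo%E -> (forall i, f i \in Lfun mu +oo%E) ->
    (\int[mu]_x (f0 x * \prod_(i < l) f i (iter (tnth n i) T x)))
      @[n --> gaps_to_infty l]
    --> (\int[mu]_x f0 x) * \prod_(i < l) \int[mu]_x f i x.

(* Main.v *)
Require Import Defs.
From HB Require Import structures.
From mathcomp Require Import all_boot all_order all_algebra.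
From mathcomp Require Import all_classical all_reals all_analysis.
From mathcomp Require Import measurable_realfun ess_sup_inf ring lra.

Set Implicit Arguments.
Unset Strict Implicit.
Unset Printing Implicit Defensive.
Import Order.TTheory GRing.Theory Num.Theory.
Import numFieldNormedType.Exports.
Local Open Scope classical_set_scope.
Local Open Scope ring_scope.

(* Multiple correlations are controlled by visits one at a time: if
   mu (A & T^-m C) < mu A * mu C for every m >= 1 and every C inside A with
   mu C > 0, then conditioning on the later visits and induction along the
   sorted times give mu (A & T^-n1 A & ... & T^-nl A) < mu A ^ (l+1), for all l
   at once; likewise with >.

   The system is x |-> 3x mod 1 on ]0, 1].  Write H j for the set of points whose
   first nonzero ternary digit is j, so H j = D j | (D 0 & T^-1 (H j)), where D i
   fixes the first digit.  Since the first digit is independent of T x, the number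
   a n = mu (H j & T^-n C) satisfies a (n+1) = (mu C + a n) / 3, whose fixed point
   is mu (H j) * mu C = mu C / 2; hence a n stays on the side of mu C / 2 on which
   a 0 lies.
   - Over-recurrence: A = H 1, where C inside A gives a 0 = mu C.
   - Under-recurrence: A = D 1 & T^-1 (H 2), which lies inside H 1, so that
     mu (A & T^-(n+1) C) = a n / 3 for j = 2, with a 0 = 0.

   For multiple mixing, the correlation of f and G o T^n tends to 0 uniformly over
   |G| <= K.  This holds with rate 3^-n for the rays f = 1_]a, +oo[, then for every
   integrable f, and is iterated along the gaps by taking for G the product of the
   later factors. *)

(** * Decorrelation and its linear and L1 closure properties *)

Section decorrelation.
Context (R : realType) (disp : measure_display) (X : measurableType disp).
Variables (P : probability X R) (T : X -> X).
Hypothesis mT : measurable_fun setT T.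

Lemma measurable_iter n : measurable_fun setT (iter n T).
Proof.
elim: n => [|n IHn]; first exact: measurable_id.
exact: (measurableT_comp mT IHn).
Qed.

Lemma bounded_integrable (f : X -> R) (K : R) : measurable_fun setT f ->
  (forall x, `|f x| <= K) -> P.-integrable setT (EFin \o f).
Proof.
move=> mf bf; apply: measurable_bounded_integrable => //.
  by rewrite -ge0_fin_numE // fin_num_measure.
by exists K; split; [exact: num_real|move=> M KM x _; exact/(le_trans (bf x))/ltW].
Qed.

Lemma integrableM_bounded (f g : X -> R) (K : R) :
  P.-integrable setT (EFin \o f) -> measurable_fun setT g ->
  (forall x, `|g x| <= K) -> P.-integrable setT (EFin \o (fun x => f x * g x)).
Proof.
move=> intf mg bg.
rewrite (_ : _ \o _ = ((EFin \o f) \* (EFin \o g))%E) //; apply: integrableMl => //.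
by exists K; split; [exact: num_real|move=> M KM x _; exact/(le_trans (bg x))/ltW].
Qed.

Lemma le_Rintegral_normM (f g : X -> R) (K : R) :
  P.-integrable setT (EFin \o f) -> measurable_fun setT g ->
  (forall x, `|g x| <= K) ->
  `|\int[P]_x (f x * g x)| <= (\int[P]_x `|f x|) * K.
Proof.
move=> intf mg bg; have ifg := integrableM_bounded intf mg bg.
apply: (le_trans (le_normr_Rintegral measurableT ifg)).
rewrite -RintegralZr //; last exact: integrable_norm.
apply: le_Rintegral => //.
- exact: integrable_norm.
- rewrite (_ : _ \o _ = (fun x => (EFin \o (Num.norm \o f)) x * K%:E)%E) //.
  by apply: integrableZr => //; exact: integrable_norm.
- by move=> x _; rewrite normrM ler_wpM2l.
Qed.

Lemma le_Rintegral_norm (g : X -> R) (K : R) : measurable_fun setT g ->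
  (forall x, `|g x| <= K) -> `|\int[P]_x g x| <= K.
Proof.
move=> mg bg.
have P1 : \int[P]_x `|cst 1 x : R| = 1.
  rewrite (@eq_Rintegral _ _ _ _ _ (cst 1)); last by move=> x _; rewrite normr1.
  by rewrite Rintegral_cst // mul1r; exact: (congr1 fine (probability_setT P)).
have := @le_Rintegral_normM (cst 1) g K _ mg bg.
rewrite P1 mul1r => h; under eq_Rintegral do rewrite -[g _]mul1r.
by apply/h/(@bounded_integrable _ 1) => // x; rewrite /= normr1.
Qed.

Definition corr (f G : X -> R) (n : nat) : R :=
  \int[P]_x (f x * G (iter n T x)) - (\int[P]_x f x) * (\int[P]_x G x).

(** [N] is chosen before [G] and [K]: later [G] is a product of translates whose times vary with the
    limit, so a rate for each fixed [G] would not do. *)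
Definition decorrelates (f : X -> R) : Prop := forall e : R, 0 < e ->
  exists N, forall n, (N <= n)%N -> forall (G : X -> R) (K : R),
    measurable_fun setT G -> (forall x, `|G x| <= K) -> `|corr f G n| <= e * K.

Lemma measurable_comp_iter (G : X -> R) n : measurable_fun setT G ->
  measurable_fun setT (fun x => G (iter n T x)).
Proof. by move=> mG; exact: (measurableT_comp mG (measurable_iter n)). Qed.

Lemma corrD (f g G : X -> R) n (K : R) :
  P.-integrable setT (EFin \o f) -> P.-integrable setT (EFin \o g) ->
  measurable_fun setT G -> (forall x, `|G x| <= K) ->
  corr (fun x => f x + g x) G n = corr f G n + corr g G n.
Proof.
move=> intf intg mG bG; rewrite /corr.
under eq_Rintegral do rewrite mulrDl.
rewrite !RintegralD //; first by ring.
- by apply: (@integrableM_bounded _ _ K) => //; exact: measurable_comp_iter.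
- by apply: (@integrableM_bounded _ _ K) => //; exact: measurable_comp_iter.
Qed.

Lemma corrZ a (f G : X -> R) n (K : R) : P.-integrable setT (EFin \o f) ->
  measurable_fun setT G -> (forall x, `|G x| <= K) ->
  corr (fun x => a * f x) G n = a * corr f G n.
Proof.
move=> intf mG bG; rewrite /corr.
under eq_Rintegral do rewrite -mulrA.
rewrite !RintegralZl //; first by ring.
by apply: (@integrableM_bounded _ _ K) => //; exact: measurable_comp_iter.
Qed.

Lemma decorrelatesD (f g : X -> R) :
  P.-integrable setT (EFin \o f) -> P.-integrable setT (EFin \o g) ->
  decorrelates f -> decorrelates g -> decorrelates (fun x => f x + g x).
Proof.
move=> intf intg df dg e e0.
have e20 : 0 < e / 2 by rewrite divr_gt0.
have [N1 h1] := df _ e20; have [N2 h2] := dg _ e20.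
exists (maxn N1 N2) => n; rewrite geq_max => /andP[n1 n2] G K mG bG.
rewrite (corrD _ _ _ mG bG) //.
apply: (le_trans (ler_normD _ _)); rewrite [e]splitr mulrDl lerD //.
- exact: h1.
- exact: h2.
Qed.

Lemma decorrelatesZ a (f : X -> R) : P.-integrable setT (EFin \o f) ->
  decorrelates f -> decorrelates (fun x => a * f x).
Proof.
move=> intf df e e0.
(* Dividing by [|a| + 1] rather than [|a|] covers a = 0. *)
have a1 : 0 < `|a| + 1 by rewrite ltr_wpDl.
have [N h] := df _ (divr_gt0 e0 a1).
exists N => n Nn G K mG bG; rewrite (corrZ _ _ _ mG bG) // normrM.
have c0 : 0 <= `|corr f G n| by [].
apply: (@le_trans _ _ ((`|a| + 1) * `|corr f G n|)).
  by rewrite ler_wpM2r // lerDl.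
by rewrite mulrC -ler_pdivlMr // mulrAC h.
Qed.

(** Replacing f by g changes the correlation by at most twice the L1 distance times [K], whatever
    [n] and [G] are; this explains the e / 4 below. *)
Lemma decorrelates_closed (f : X -> R) : P.-integrable setT (EFin \o f) ->
  (forall e, 0 < e -> exists g, [/\ P.-integrable setT (EFin \o g),
     decorrelates g & \int[P]_x `|f x - g x| <= e]) ->
  decorrelates f.
Proof.
move=> intf apx e e0; have e40 : 0 < e / 4 by rewrite divr_gt0.
have [g [intg dg fg]] := apx _ e40.
have [N h] := dg _ (divr_gt0 e0 (ltr0Sn _ 1)).
exists N => n Nn G K mG bG.
have intfg : P.-integrable setT (EFin \o (fun x => f x - g x)).
  by rewrite (_ : _ \o _ = (EFin \o f) \- (EFin \o g))%E //; exact: integrableB.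
rewrite (_ : f = (fun x => (f x - g x) + g x)); last first.
  by apply/funext => x; rewrite subrK.
rewrite (corrD _ _ _ mG bG) //; apply: (le_trans (ler_normD _ _)).
rewrite [e]splitr mulrDl lerD //; last exact: h.
have K0 : 0 <= K by apply: le_trans (bG point); exact: normr_ge0.
rewrite /corr; apply: (le_trans (ler_normB _ _)).
have -> : e / 2 = e / 4 + e / 4 by field.
rewrite mulrDl lerD //.
  apply: (le_trans (@le_Rintegral_normM _ _ K _ _ _)) => //.
    exact: measurable_comp_iter.
  exact: ler_wpM2r.
rewrite normrM ler_pM //; last exact: le_Rintegral_norm.
exact: le_trans (le_normr_Rintegral _ _) fg.
Qed.

(** * Invariant measures: decorrelation from a generating pi-system to all integrable functions *)

Hypothesis presT : forall A, measurable A -> P (T @^-1` A) = P A.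

Lemma preserving_iter n A : measurable A -> P (iter n T @^-1` A) = P A.
Proof.
elim: n A => [//|n IHn] A mA.
rewrite (_ : iter n.+1 T @^-1` A = iter n T @^-1` (T @^-1` A)) //.
by rewrite IHn ?presT // -[X in measurable X]setTI; exact: mT.
Qed.

Lemma Rintegral_iter (G : X -> R) n (K : R) : measurable_fun setT G ->
  (forall x, `|G x| <= K) -> \int[P]_x G (iter n T x) = \int[P]_x G x.
Proof.
move=> mG bG; rewrite /Rintegral; congr fine.
have iG : P.-integrable (iter n T @^-1` setT) ((EFin \o G) \o iter n T).
  by rewrite preimage_setT; apply: (@bounded_integrable _ K) => //;
    exact: measurable_comp_iter.
have mEG : measurable_fun setT (EFin \o G) by exact/measurable_EFinP.
rewrite -(preimage_setT (iter n T)).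
rewrite -[LHS](integral_pushforward (measurable_iter n) mEG iG measurableT).
apply: eq_measure_integral => [|mI A mA _]; first exact: measurable_iter.
exact: preserving_iter.
Qed.

Lemma decorrelates_cst c : decorrelates (cst c).
Proof.
move=> e e0; exists 0%N => n _ G K mG bG.
have mGn := measurable_comp_iter n mG.
have bGn x : `|G (iter n T x)| <= K by [].
rewrite /corr RintegralZl //; last exact: (@bounded_integrable _ K).
rewrite (Rintegral_iter n mG bG) Rintegral_cst //.
rewrite (_ : fine _ = 1); last exact: (congr1 fine (probability_setT P)).
rewrite mulr1 subrr normr0 mulr_ge0 ?(ltW e0) //.
exact: le_trans (normr_ge0 _) (bG point).
Qed.

Lemma integrable_indicR (A : set X) : measurable A ->
  P.-integrable setT (EFin \o (\1_A : X -> R)).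
Proof. exact: integrable_indic. Qed.

Lemma Rintegral_indic (A : set X) : measurable A ->
  \int[P]_x (\1_A x : R) = fine (P A).
Proof. by move=> mA; rewrite /Rintegral integral_indic // setIT. Qed.

Lemma Rintegral_distr_indic (A B : set X) : measurable A -> measurable B ->
  B `<=` A -> \int[P]_x `|\1_A x - \1_B x : R| = fine (P A) - fine (P B).
Proof.
move=> mA mB BA; rewrite -!Rintegral_indic // -RintegralB //; last 2 first.
- exact: integrable_indicR.
- exact: integrable_indicR.
apply: eq_Rintegral => x _; rewrite ger0_norm // subr_ge0 !indicE ler_nat.
by have [/set_mem/BA/mem_set ->|] := boolP (x \in B).
Qed.

Lemma decorrelates_indicC (A : set X) : measurable A ->
  decorrelates (\1_A) -> decorrelates (\1_(~` A)).
Proof.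
move=> mA dA.
rewrite (_ : \1_(~` A) = (fun x => cst 1 x + -1 * \1_A x)).
  apply: decorrelatesD.
  - by apply: (@bounded_integrable _ 1) => // x; rewrite /= normr1.
  - apply: (@bounded_integrable _ 1) => [|x].
      by apply: measurable_funM => //; exact: measurable_indic.
    by rewrite mulN1r normrN indicE ger0_norm ?ler0n // lern1 leq_b1.
  - exact: decorrelates_cst.
  - by apply: decorrelatesZ => //; exact: integrable_indicR.
apply/funext => x; rewrite mulN1r !indicE in_setC /=.
by case: (x \in A); rewrite ?subrr ?subr0.
Qed.

Lemma decorrelates_indic_bigsetU (F : (set X)^nat) n :
  (forall k, measurable (F k)) -> trivIset setT F ->
  (forall k, decorrelates (\1_(F k))) ->
  decorrelates (\1_(\big[setU/set0]_(k < n) F k)).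
Proof.
move=> mF tF dF; elim: n => [|n IHn].
  by rewrite big_ord0 indic0; exact: decorrelates_cst.
have mU : measurable (\big[setU/set0]_(k < n) F k).
  by apply: bigsetU_measurable => k _.
rewrite big_ord_recr /= (_ : \1_ _ =
    (fun x => \1_(\big[setU/set0]_(k < n) F k) x + \1_(F n) x)).
  exact: decorrelatesD (integrable_indicR _) (integrable_indicR _) _ _.
have /disjoints_subset UF : \big[setU/set0]_(k < n) F k `&` F n = set0.
  rewrite -bigcup_mkord setI_bigcupl bigcup0 // => k /= kn.
  by move/trivIsetP : tF; apply => //; rewrite ltn_eqF.
apply/funext => x; rewrite !indicE in_setU.
have [/set_mem/UF xF|] := boolP (x \in \big[setU/set0]_(k < n) F k).
  by rewrite (memNset xF) addr0.
by rewrite add0r.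
Qed.

(** Dynkin's argument: the sets with decorrelating indicator are stable under complement and under
    countable disjoint union, where the finite partial unions converge to the whole union in L1 by
    continuity from below. *)
Lemma decorrelates_indic (C : set (set X)) :
  @measurable _ X = <<s C >> -> setI_closed C ->
  (forall A, C A -> decorrelates (\1_A)) ->
  forall A, measurable A -> decorrelates (\1_A).
Proof.
move=> mC IC dC A mA.
have mC' : <<s C >> A by rewrite -mC.
move: A mC' {mA}; apply: (dynkin_induction mC IC) => //.
- by rewrite indicT; exact: decorrelates_cst.
- by move=> A mA; exact: decorrelates_indicC.
- move=> F mF tF dF.
  have mU n : measurable (\big[setU/set0]_(k < n) F k).
    by apply: bigsetU_measurable => k _.
  apply: decorrelates_closed => [|e e0].
    by apply: integrable_indicR; exact: bigcupT_measurable.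
  have cvg : fine (P (\big[setU/set0]_(k < n.+1) F k)) @[n --> \oo] -->
      fine (P (\bigcup_k F k)).
    apply: fine_cvg; rewrite fineK ?fin_num_measure //; last first.
      exact: bigcupT_measurable.
    rewrite -bigcup_bigsetU_bigcup.
    apply: (nondecreasing_cvg_mu (mu := P)) => //; first exact: bigcupT_measurable.
    by apply/nondecreasing_seqP => n; apply/subsetPset; 
      rewrite [X in _ `<=` X]big_ord_recr /=; exact: subsetUl.
  have /cvgrPdist_le/(_ e e0)[n _ /(_ n (leqnn n)) /= hn] := cvg.
  exists (\1_(\big[setU/set0]_(k < n.+1) F k)); split.
  + exact: integrable_indicR.
  + exact: decorrelates_indic_bigsetU.
  + rewrite Rintegral_distr_indic //; first exact: le_trans (ler_norm _) hn.
      exact: bigcupT_measurable.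
    by rewrite -bigcup_mkord => x [k _ Fx]; exists k.
Qed.

Import HBSimple.

(** Simple functions are dense in L1 and are finite combinations of indicators. *)
Lemma decorrelates_integrable (f : X -> R) :
  (forall A, measurable A -> decorrelates (\1_A)) ->
  P.-integrable setT (EFin \o f) -> decorrelates f.
Proof.
move=> dA intf; apply: decorrelates_closed => // e e0.
have [g [intg _ cvg]] := approximation_sfun_integrable measurableT intf.
have /fine_cvgP[_ /cvgr0Pnorm_le/(_ e e0)[n _ /(_ n (leqnn n)) /= hn]] := cvg.
exists (g n); split => //; last exact: le_trans (ler_norm _) hn.
have fing : finite_set (range (g n)) by exact: fimfunP.
have mg y : measurable (g n @^-1` [set y]) by exact: measurable_sfunP.
rewrite (_ : (g n : X -> R) =
    (fun x => \sum_(y <- finmap.enum_fset (fset_set (range (g n))))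
      y * \1_(g n @^-1` [set y]) x)); last first.
  by apply/funext => x; rewrite fimfunE fsbig_finite.
pose simple s x : R := \sum_(y <- s) y * \1_(g n @^-1` [set y]) x.
have intZ y : P.-integrable setT (EFin \o (fun x => y * \1_(g n @^-1` [set y]) x)).
  rewrite (_ : _ \o _ = (fun x => y%:E * (\1_(g n @^-1` [set y]) x)%:E))%E //.
  by apply: integrableZl => //; exact: integrable_indic.
suff : forall s, P.-integrable setT (EFin \o simple s) /\ decorrelates (simple s).
  by move=> /(_ (finmap.enum_fset (fset_set (range (g n)))))[].
elim=> [|y s [ints ds]].
  rewrite (_ : simple [::] = cst 0); last first.
    by apply/funext => x; rewrite /simple big_nil.
  by split; [exact: integrable0|exact: decorrelates_cst].
rewrite (_ : simple (y :: s) = (fun x => y * \1_(g n @^-1` [set y]) x + simple s x)).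
  split.
    exact: integrableD (intZ y) ints.
  apply: decorrelatesD => //; apply: decorrelatesZ; first exact: integrable_indicR.
  exact: dA.
by apply/funext => x; rewrite /simple big_cons.
Qed.

Lemma measurable_orbit_prod (f : nat -> X -> R) (m : nat -> nat) l :
  (forall i, measurable_fun setT (f i)) ->
  measurable_fun setT (fun x => \prod_(j < l) f j (iter (m j) T x)).
Proof.
move=> mf; elim: l => [|l IHl].
  by under eq_fun do rewrite big_ord0; exact: measurable_cst.
under eq_fun do rewrite big_ord_recr /=.
by apply: measurable_funM => //; exact: measurable_comp_iter.
Qed.

Lemma orbit_prod_bounded (f : nat -> X -> R) (m : nat -> nat) l (K : R) x :
  (forall i x, `|f i x| <= K) -> `|\prod_(j < l) f j (iter (m j) T x)| <= K ^+ l.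
Proof.
move=> bf; rewrite normr_prod -[in leRHS](card_ord l) -prodr_const.
by apply: ler_prod => j _; rewrite normr_ge0 bf.
Qed.

(** * From decorrelation to multiple mixing *)

Hypothesis decT : forall f, P.-integrable setT (EFin \o f) -> decorrelates f.

(** [k] is the time of the base point; with it the tail of the list of times is an instance of the
    same statement, based at its first time. One step costs e / 2 for separating [f 0] from the rest
    [G], plus [K] times the inductive error e / (2 * K). *)
Lemma bounded_multiple_mixing (K : R) l : 0 < K ->
  forall f : nat -> X -> R,
  (forall i, measurable_fun setT (f i)) -> (forall i x, `|f i x| <= K) ->
  forall e, 0 < e -> exists N, forall k (n : seq nat),
    size n = l -> path (fun a b => a + N <= b)%N k n ->
    `|\int[P]_x (f 0%N x * \prod_(j < l) f j.+1 (iter (nth 0 n j - k) T x))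
      - \prod_(j < l.+1) \int[P]_x f j x| <= e.
Proof.
move=> K0; elim: l => [|l IHl] f mf bf e e0.
  exists 0%N => k n _ _; rewrite big_ord1.
  under eq_Rintegral do rewrite big_ord0 mulr1.
  by rewrite subrr normr0 ltW.
have Kl0 : 0 < 2 * K ^+ l.+1 by rewrite mulr_gt0 ?exprn_gt0.
have K20 : 0 < 2 * K by rewrite mulr_gt0.
have [N1 h1] := decT (bounded_integrable (mf 0%N) (bf 0%N)) (divr_gt0 e0 Kl0).
have [N2 h2] := IHl (fun i => f i.+1) (fun i => mf i.+1) (fun i => bf i.+1) _
  (divr_gt0 e0 K20).
exists (maxn N1 N2) => k [//|n1 n] [sz] /= /andP[kn1 pn].
(* The times increase, so the truncated subtractions of [n1] are exact. *)
have n1_min j : (j < l)%N -> (n1 <= nth 0 n j)%N.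
  move=> jl; have : path leq n1 n.
    by apply: sub_path pn => a b; apply: leq_trans; exact: leq_addr.
  by move/(order_path_min leq_trans)/(all_nthP 0%N); apply; rewrite sz.
have k_n1 : (k <= n1)%N by apply: leq_trans kn1; exact: leq_addr.
pose G x := f 1%N x * \prod_(j < l) f j.+2 (iter (nth 0 n j - n1) T x).
have GE x : \prod_(j < l.+1) f j.+1 (iter (nth 0 (n1 :: n) j - k) T x) =
    G (iter (n1 - k) T x).
  rewrite big_ord_recl /G /=; congr (_ * _); apply: eq_bigr => j _.
  by rewrite -iterD addnBA // subnK // n1_min.
under eq_Rintegral do rewrite GE.
have mG : measurable_fun setT G.
  apply: measurable_funM => //.
  exact: (@measurable_orbit_prod (fun i => f i.+2) (fun j => (nth 0 n j - n1)%N)).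
have bG x : `|G x| <= K ^+ l.+1.
  rewrite normrM exprS ler_pM //.
  exact: (@orbit_prod_bounded (fun i => f i.+2) (fun j => (nth 0 n j - n1)%N)).
have {}h1 : `|corr (f 0%N) G (n1 - k)| <= e / 2.
  have le1 : (N1 <= n1 - k)%N.
    by rewrite leq_subRL // (leq_trans _ kn1) // leq_add2l leq_maxl.
  apply: le_trans (h1 _ le1 _ _ mG bG) _.
  by rewrite invfM mulrA divfK // expf_neq0 // gt_eqF.
have {}h2 : `|\int[P]_x G x - \prod_(j < l.+1) \int[P]_x f j.+1 x| <= e / (2 * K).
  apply: h2 => //; apply: sub_path pn => a b; apply: leq_trans.
  by rewrite leq_add2l leq_maxr.
rewrite big_ord_recl.
rewrite (_ : _ - _ = corr (f 0%N) G (n1 - k) +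
  \int[P]_x f 0%N x *
    (\int[P]_x G x - \prod_(j < l.+1) \int[P]_x f j.+1 x)); last first.
  by rewrite /corr; ring.
apply: le_trans (ler_normD _ _) _; rewrite [e]splitr lerD // normrM.
rewrite (_ : e / 2 = K * (e / (2 * K))); last by field; rewrite gt_eqF.
by rewrite ler_pM // (le_Rintegral_norm (mf 0%N)).
Qed.

(** Setting f to 0 where it exceeds an essential bound makes the bound hold everywhere; the maximum
    with 0 keeps it valid at the points so modified. *)
Lemma Lfun_bounded (f : X -> R) : f \in Lfun P +oo%E ->
  exists (g : X -> R) (K : R), [/\ measurable_fun setT g, (forall x, `|g x| <= K) &
    {ae P, forall x, f x = g x}].
Proof.
rewrite inE => /andP[]; rewrite !inE /= => mf.
rewrite /finite_norm unlock (_ : 0 < P setT)%E; last first.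
  by have := probability_setT P => /= ->; exact: lte01.
rewrite (_ : abse \o _ = EFin \o (Num.norm \o f)); last exact/funext.
move=> /ess_supr_bounded[K fK].
pose A := f @^-1` `[- Num.max K 0, Num.max K 0].
exists (fun x => f x * \1_A x), (Num.max K 0); split.
- apply: measurable_funM => //; apply: measurable_indic.
  by rewrite -[A]setTI; exact: mf.
- move=> x; rewrite indicE; have [/set_mem|] := boolP (x \in A).
    by rewrite /A /= in_itv /= -ler_norml mulr1.
  by rewrite mulr0 normr0 le_max lexx orbT.
- apply: filterS fK => x /= fK; rewrite indicE mem_set ?mulr1 //.
  by rewrite /A /= in_itv /= -ler_norml le_max fK.
Qed.

Lemma ae_iter (Q : X -> Prop) n : {ae P, forall x, Q x} ->
  {ae P, forall x, Q (iter n T x)}.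
Proof.
move=> [N [mN PN QN]]; exists (iter n T @^-1` N); split.
- by rewrite -[X in measurable X]setTI; exact: measurable_iter.
- by rewrite preserving_iter.
- by move=> x /= Qx; exact: QN.
Qed.

Lemma eq_ae_Rintegral (f g : X -> R) : measurable_fun setT f ->
  measurable_fun setT g -> {ae P, forall x, f x = g x} ->
  \int[P]_x f x = \int[P]_x g x.
Proof.
move=> mf mg fg; congr fine; apply: ae_eq_integral => //.
- exact/measurable_EFinP.
- exact/measurable_EFinP.
- by apply: filterS fg => x /= -> _.
Qed.

Lemma decorrelates_multiple_mixing : multiple_mixing P T.
Proof.
move=> l f0 f _ Lf0 Lf.
(* [f0] and the finite family [f] become one sequence indexed by nat, padded with 0 beyond index
   [l]. *)
pose h i : X -> R := if i is j.+1 then oapp f (cst 0) (insub j) else f0.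
have hE (j : 'I_l) : h j.+1 = f j by rewrite /h valK.
have mh i : measurable_fun setT (h i).
  have mL (u : X -> R) : u \in Lfun P +oo%E -> measurable_fun setT u.
    by rewrite inE => /andP[]; rewrite !inE.
  case: i => [|i] /=; first exact: mL.
  by case: insub => [j|] /=; [exact: mL|exact: measurable_cst].
have /choice[gK] : forall i, exists gK : (X -> R) * R, [/\ measurable_fun setT gK.1,
    (forall x, `|gK.1 x| <= gK.2) & {ae P, forall x, h i x = gK.1 x}].
  have ex (u : X -> R) : u \in Lfun P +oo%E -> exists gK : (X -> R) * R,
    [/\ measurable_fun setT gK.1, (forall x, `|gK.1 x| <= gK.2) &
    {ae P, forall x, u x = gK.1 x}].
    by move=> /Lfun_bounded[g [K ?]]; exists (g, K).
  case=> [|i] /=; first exact: ex.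
  case: insub => [j|] /=; first exact: ex.
  exists (cst 0, 0); split => //=; [by move=> x; rewrite normr0|exact: aeW].
move=> gKP.
(* Cutting off beyond [l] lets a sum of finitely many bounds control every [g i]; the added 1 makes
   [K] positive. *)
pose g i : X -> R := if (i <= l)%N then (gK i).1 else cst 0.
pose K := \sum_(i < l.+1) `|(gK i).2| + 1.
have K0 : 0 < K by rewrite ltr_wpDl // sumr_ge0.
have mg i : measurable_fun setT (g i).
  by rewrite /g; case: ifP => _ //; have [] := gKP i.
have bg i x : `|g i x| <= K.
  rewrite /g; case: ifP => [il|_]; last by rewrite normr0 ltW.
  have [_ /(_ x) bgi _] := gKP i.
  apply: (le_trans bgi); apply: (le_trans (ler_norm _)).
  rewrite /K (bigD1 (Ordinal (il : (i < l.+1)%N))) //= -addrA lerDl addr_ge0 //.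
  exact: sumr_ge0.
have hg i : (i <= l)%N -> {ae P, forall x, h i x = g i x}.
  by move=> il; rewrite /g il; have [] := gKP i.
have -> : (\int[P]_x f0 x) * \prod_(i < l) \int[P]_x f i x =
    \prod_(i < l.+1) \int[P]_x g i x.
  rewrite big_ord_recl; congr (_ * _).
    by apply: eq_ae_Rintegral => //; [exact: (mh 0%N)|exact: (hg 0%N)].
  apply: eq_bigr => i _; rewrite -hE; apply: eq_ae_Rintegral => //.
  exact: (hg i.+1).
apply/cvgrPdist_le => e e0.
have [N hN] := bounded_multiple_mixing l K0 mg bg e0.
exists N => // n /= pn; rewrite distrC.
rewrite (_ : \int[P]_x _ = \int[P]_x
    (g 0%N x * \prod_(j < l) g j.+1 (iter (nth 0 n j - 0) T x))).
  by apply: hN => //; rewrite size_tuple.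
apply: eq_ae_Rintegral.
- apply: measurable_funM; first exact: (mh 0%N).
  under eq_fun do under eq_bigr do rewrite -hE (tnth_nth 0%N).
  exact: (@measurable_orbit_prod (fun i => h i.+1) (fun j => nth 0%N n j)).
- apply: measurable_funM => //.
  exact: (@measurable_orbit_prod (fun i => g i.+1) (fun j => (nth 0 n j - 0)%N)).
- have hg0 := hg 0%N (leq0n l).
  (* By invariance the exceptional sets stay null when pulled back to the times of the orbit, and
     there are finitely many of them. *)
  have hgn : {ae P, forall x, forall j : 'I_l,
      h j.+1 (iter (tnth n j) T x) = g j.+1 (iter (tnth n j) T x)}.
    apply: filter_forall => j.
    apply: (@ae_iter (fun x => h j.+1 x = g j.+1 x)). exact: hg.
  apply: (filterS2 _ _ hg0 hgn) => x h0 hgx; congr (_ * _); first exact: h0.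
  by apply: eq_bigr => j _; rewrite -hE hgx subn0 (tnth_nth 0%N).
Qed.

End decorrelation.

(** * Maps with three full branches of mass 1/3, and the two recurrent sets *)

Section ternary_branches.
Context (R : realType) (disp : measure_display) (X : measurableType disp).
Variables (P : probability X R) (T : X -> X) (digit : X -> nat).
Hypothesis mT : measurable_fun setT T.
Let D i := digit @^-1` [set i].
Hypothesis mD : forall i, measurable (D i).
Hypothesis digit_lt3 : forall x, (digit x < 3)%N.
Hypothesis branchP : forall i C, (i < 3)%N -> measurable C ->
  P (D i `&` T @^-1` C) = (3^-1%:E * P C)%E.
Let pr A := fine (P A).

Lemma prU (A B : set X) : measurable A -> measurable B -> A `&` B = set0 ->
  pr (A `|` B) = pr A + pr B.
Proof.
by move=> mA mB AB; rewrite /pr measureU // fineD // fin_num_measure.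
Qed.

Lemma pr_branch i C : (i < 3)%N -> measurable C ->
  pr (D i `&` T @^-1` C) = pr C / 3.
Proof.
by move=> i3 mC; rewrite /pr branchP // fineM ?fin_num_measure // mulrC.
Qed.

Lemma measurable_preimage (A : set X) : measurable A -> measurable (T @^-1` A).
Proof. by move=> mA; rewrite -[X in measurable X]setTI; exact: mT. Qed.

Lemma branch_disjoint i j (A B : set X) : i != j ->
  (D i `&` A) `&` (D j `&` B) = set0.
Proof.
move=> /eqP ij; apply/seteqP; split => // x [[Di _] [Dj _]].
by case: ij; rewrite -Di -Dj.
Qed.

Lemma ternary_preserving A : measurable A -> P (T @^-1` A) = P A.
Proof.
move=> mA; have mTA := measurable_preimage mA.
have mDT i : measurable (D i `&` T @^-1` A) by exact: measurableI.
rewrite -[LHS]fineK ?fin_num_measure // -[RHS]fineK ?fin_num_measure //; congr EFin.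
rewrite -/(pr _) (_ : T @^-1` A = (D 0 `&` T @^-1` A) `|`
    ((D 1 `&` T @^-1` A) `|` (D 2 `&` T @^-1` A))).
  rewrite prU //; last 2 first.
  - exact: measurableU.
  - by rewrite setIUr !branch_disjoint // setU0.
  rewrite prU //; last by rewrite branch_disjoint.
  by rewrite !pr_branch // /pr; field.
rewrite -!setIUl setIC; apply/seteqP; split=> x; last by case.
move=> Ax; split => //; rewrite /D /=.
by case: (digit x) (digit_lt3 x) => [|[|[|]]] // _; [left|right; left|right; right].
Qed.

Fixpoint leading_zeros (j n : nat) : set X :=
  if n is m.+1 then D 0 `&` T @^-1` leading_zeros j m else D j.

Definition first_nonzero j := \bigcup_n leading_zeros j n.

Lemma measurable_first_nonzero j : measurable (first_nonzero j).
Proof.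
apply: bigcupT_measurable => n; elim: n => [|n IHn]; first exact: mD.
by apply: measurableI => //; exact: measurable_preimage.
Qed.

Lemma first_nonzeroE j : first_nonzero j = D j `|` (D 0 `&` T @^-1` first_nonzero j).
Proof.
apply/seteqP; split=> x.
  by case=> -[|n] _ /=; [left|move=> [? ?]; right; split=> //; exists n].
by case=> [Djx|[D0x [n _ ?]]]; [exists 0%N|exists n.+1].
Qed.

Lemma first_nonzero_disjoint : first_nonzero 1 `&` first_nonzero 2 = set0.
Proof.
have h m : forall n x, leading_zeros 1 m x -> ~ leading_zeros 2 n x.
  elim: m => [|m IHm] [|n] x /=; rewrite /D /=.
  - by move=> ->.
  - by move=> -> [].
  - by move=> [-> _].
  - by move=> [_ xm] [_]; exact: IHm.
by apply/seteqP; split => // x [[m _ xm] [n _ xn]]; exact: (h _ _ _ xm xn).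
Qed.

(** The first digit is either j, or 0 with the question passed on to T x, and each branch
    contributes a third. Applied to preimages of C, this is the recursion for a n. *)
Lemma pr_first_nonzeroI j C : (0 < j < 3)%N -> measurable C ->
  pr (first_nonzero j `&` T @^-1` C) = (pr C + pr (first_nonzero j `&` C)) / 3.
Proof.
move=> /andP[j0 j3] mC; have mF := measurable_first_nonzero j.
have mFC : measurable (first_nonzero j `&` C) by exact: measurableI.
rewrite (_ : first_nonzero j `&` T @^-1` C = (D j `&` T @^-1` C) `|`
   (D 0 `&` T @^-1` (first_nonzero j `&` C))); last first.
  by rewrite [in LHS]first_nonzeroE setIUl preimage_setI setIA.
rewrite prU ?pr_branch // ?mulrDl // ?branch_disjoint ?gt_eqF //.
- by apply: measurableI => //; exact: measurable_preimage.
- by apply: measurableI => //; exact: measurable_preimage.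
Qed.

Lemma pr_first_nonzero j : (0 < j < 3)%N -> pr (first_nonzero j) = 2^-1.
Proof.
(* For the whole space the recursion reads p = (1 + p) / 3. *)
move=> j3; have := pr_first_nonzeroI j3 measurableT.
rewrite preimage_setT !setIT (_ : pr setT = 1); last by rewrite /pr probability_setT.
by lra.
Qed.

Lemma measurable_preimage_iter n (A : set X) :
  measurable A -> measurable (iter n T @^-1` A).
Proof.
by move=> mA; rewrite -[X in measurable X]setTI; exact: measurable_iter.
Qed.

Lemma pr_iter n (A : set X) : measurable A -> pr (iter n T @^-1` A) = pr A.
Proof. by move=> mA; rewrite /pr (preserving_iter mT ternary_preserving). Qed.

Lemma first_nonzero_over C n : measurable C -> C `<=` first_nonzero 1 -> 0 < pr C ->
  pr (first_nonzero 1) * pr C < pr (first_nonzero 1 `&` iter n T @^-1` C).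
Proof.
move=> mC CF C0; rewrite pr_first_nonzero //; elim: n => [|n IHn].
  by rewrite /= preimage_id setIidr //; lra.
have mCn := measurable_preimage_iter n mC.
rewrite (_ : iter n.+1 T @^-1` C = T @^-1` (iter n T @^-1` C)); last first.
  by apply/seteqP; split=> x /=; rewrite -iterSr.
(* With c = [pr C], a n > c / 2 gives (c + a n) / 3 > c / 2. *)
rewrite pr_first_nonzeroI // pr_iter //; lra.
Qed.

(** After its initial 1, a point of this set meets a 2 before any further 1, while a return needs a
    1; this delay pushes the correlations below the product. *)
Definition isolated_one := D 1 `&` T @^-1` first_nonzero 2.

Lemma measurable_isolated_one : measurable isolated_one.
Proof.
apply: measurableI => //; apply: measurable_preimage; exact: measurable_first_nonzero.
Qed.

Lemma pr_isolated_one : pr isolated_one = 6^-1.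
Proof.
rewrite pr_branch ?pr_first_nonzero //; last exact: measurable_first_nonzero.
by field.
Qed.

Lemma isolated_one_under C n : measurable C -> C `<=` isolated_one -> 0 < pr C ->
  (0 < n)%N -> pr (isolated_one `&` iter n T @^-1` C) < pr isolated_one * pr C.
Proof.
move=> mC CF C0; case: n => // n _.
(* The initial value a 0 = 0: C starts with the digit 1, hence misses the points whose first nonzero
   digit is 2. *)
have F2C : pr (first_nonzero 2 `&` C) = 0.
  rewrite (_ : _ `&` C = set0) ?/pr ?measure0 //.
  apply/seteqP; split => // x [F2x /CF[D1x _]].
  have : (first_nonzero 1 `&` first_nonzero 2) x by split=> //; exists 0%N.
  by rewrite first_nonzero_disjoint.
have lt m : pr (first_nonzero 2 `&` iter m T @^-1` C) < pr C / 2.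
  elim: m => [|m IHm].
    by rewrite /= preimage_id F2C; lra.
  have mCm := measurable_preimage_iter m mC.
  rewrite (_ : iter m.+1 T @^-1` C = T @^-1` (iter m T @^-1` C)); last first.
    by apply/seteqP; split=> x /=; rewrite -iterSr.
  rewrite pr_first_nonzeroI // pr_iter //; lra.
rewrite (_ : _ `&` _ =
    D 1 `&` T @^-1` (first_nonzero 2 `&` iter n T @^-1` C)); last first.
  rewrite /isolated_one -setIA; congr (_ `&` _).
  rewrite preimage_setI; congr (_ `&` _).
  by apply/seteqP; split=> x /=; rewrite -iterSr.
rewrite pr_branch //; last first.
  apply: measurableI; first exact: measurable_first_nonzero.
  exact: measurable_preimage_iter.
(* The branch divides the bound [pr C / 2] by 3, giving exactly the product with 1/6. *)
by have := lt n; rewrite pr_isolated_one; lra.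
Qed.

(** By [branchP], the image under T of P restricted to [D i] is a third of P; the rest is change of
    variables. *)
Lemma ge0_integral_branch i (f : X -> \bar R) : (i < 3)%N ->
  measurable_fun setT f -> (forall x, 0 <= f x)%E ->
  (\int[P]_(x in D i) f (T x) = 3^-1%:E * \int[P]_x f x)%E.
Proof.
move=> i3 mf f0.
have mfT : measurable_fun setT (f \o T) by exact: measurableT_comp.
have c0 : 0 <= 3^-1 :> R by [].
transitivity (\int[mscale (NngNum c0) P]_x f x)%E; last first.
  by rewrite ge0_integral_mscale.
transitivity (\int[pushforward (mrestr P (mD i)) T]_x f x)%E; last first.
  apply: eq_measure_integral => A mA _.
  by rewrite /= /mscale /= /pushforward /mrestr setIC branchP.
rewrite ge0_integral_pushforward // preimage_setT.
rewrite (ge0_negligible_integral (N := ~` D i)) //=.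
- rewrite setTD setCK; apply: eq_measure_integral => A mA AD.
  by rewrite /= /mrestr setIidl.
- exact: measurableC.
- by rewrite /mrestr setICl measure0.
Qed.

Lemma Rintegral_branch i (f : X -> R) (K : R) : (i < 3)%N ->
  measurable_fun setT f -> (forall x, `|f x| <= K) ->
  \int[P]_x (\1_(D i) x * f (T x)) = (\int[P]_x f x) / 3.
Proof.
move=> i3 mf bf.
have branch0 (g : X -> R) : measurable_fun setT g -> (forall x, 0 <= g x) ->
    P.-integrable setT (EFin \o g) ->
    \int[P]_x (\1_(D i) x * g (T x)) = (\int[P]_x g x) / 3.
  move=> mg g0 ig; rewrite (@eq_Rintegral _ _ _ _ _ ((fun x => g (T x)) \_ (D i))).
    rewrite -Rintegral_mkcond /Rintegral (ge0_integral_branch i3 (f := EFin \o g)).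
    - by rewrite fineM ?integrable_fin_num // mulrC.
    - exact/measurable_EFinP.
    - by move=> x; rewrite lee_fin.
  move=> x _; rewrite patchE indicE.
  by case: (x \in D i); rewrite ?mul1r ?mul0r.
(* Adding [K] makes f nonnegative; the contribution of the constant, itself covered by [branch0],
   cancels at the end. *)
have mfK : measurable_fun setT (fun x => f x + K) by apply: measurable_funD.
have iK : P.-integrable setT (EFin \o cst K).
  by apply: (@bounded_integrable _ _ _ _ _ `|K|).
have iF : P.-integrable setT (EFin \o f) by exact: bounded_integrable bf.
have ifK : P.-integrable setT (EFin \o (fun x => f x + K)) by exact: integrableD iF iK.
have K0 : 0 <= K by apply: le_trans (bf point); exact: normr_ge0.
have mfT : measurable_fun setT (f \o T) by exact: measurableT_comp.
have mI : measurable_fun setT (\1_(D i) : X -> R) by exact: measurable_indic.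
have I1 x : `|\1_(D i) x : R| <= 1.
  by rewrite indicE ger0_norm ?ler0n // lern1 leq_b1.
have fK0 x : 0 <= f x + K.
  by rewrite -lerBlDr sub0r; have := bf x; rewrite ler_norml => /andP[].
have iIf : P.-integrable setT (EFin \o (fun x => \1_(D i) x * f (T x))).
  apply: (@bounded_integrable _ _ _ _ _ K); first exact: measurable_funM.
  by move=> x; rewrite normrM -[leRHS]mul1r ler_pM.
have iIK : P.-integrable setT (EFin \o (fun x => \1_(D i) x * K)).
  apply: (@bounded_integrable _ _ _ _ _ K); first exact: measurable_funM.
  by move=> x; rewrite normrM (ger0_norm K0) -[leRHS]mul1r ler_pM.
have := branch0 _ mfK fK0 ifK; under eq_Rintegral do rewrite mulrDr.
rewrite (RintegralD _ iIf iIK) // (RintegralD _ iF iK) // mulrDl.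
by rewrite -(branch0 (cst K)) // => /addIr.
Qed.

End ternary_branches.

(** * From one visit to several: induction along the sorted times *)

Section successive_visits.
Context (R : realType) (disp : measure_display) (X : measurableType disp).
Variables (P : probability X R) (T : X -> X) (A : set X).
Hypotheses (mT : measurable_fun setT T) (mA : measurable A).
Hypothesis presT : forall B, measurable B -> P (T @^-1` B) = P B.
Let pr B := fine (P B).

(* [n] lists absolute times in increasing order, while the base point is the state
   at time [k]; the subtraction is truncated if [n] is not sorted. *)
Fixpoint visits (k : nat) (n : seq nat) : set X :=
  if n is m :: n' then A `&` iter (m - k) T @^-1` visits m n' else A.

Lemma measurable_visits k n : measurable (visits k n).
Proof.
elim: n k => [//|m n IHn] k; apply: measurableI => //.
by rewrite -[X in measurable X]setTI; exact: measurable_iter.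
Qed.

Lemma visits_sub k n : visits k n `<=` A.
Proof. by case: n => [//|m n] x []. Qed.

Lemma visitsE k n x : path leq k n ->
  visits k n x <-> A x /\ forall m, m \in n -> A (iter (m - k) T x).
Proof.
elim: n k x => [|m n IHn] k x /=; first by split=> [//|[]].
move=> /andP[km pn]; rewrite /= IHn //.
have mE i : i \in n -> (i - m + (m - k) = i - k)%N.
  by move=> /(allP (order_path_min leq_trans pn)) mi; rewrite addnBA // subnK.
split=> [[Ax [Am An]]|[Ax An]]; split=> //.
- by move=> i; rewrite inE => /predU1P[->//|i_n]; rewrite -mE // iterD; exact: An.
- split; first by apply: An; rewrite mem_head.
  by move=> i i_n; rewrite -iterD mE //; apply: An; rewrite inE i_n orbT.
Qed.

(** The intersection ignores the order of the times, so they may be sorted. *)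
Lemma visits_bigcap l (n : l.-tuple nat) :
  A `&` \bigcap_(i in [set: 'I_l]) (iter (tnth n i) T @^-1` A) =
  visits 0 (sort leq n).
Proof.
have ps : path leq 0 (sort leq n).
  by rewrite path_min_sorted; [exact: (sort_sorted leq_total)|exact/allP].
apply/seteqP; split=> x.
  move=> [Ax An]; apply/visitsE => //; split=> // m.
  by rewrite mem_sort subn0 => /tnthP[i ->]; exact: An.
move=> /visitsE[] // Ax An; split=> // i _ /=.
by rewrite -(subn0 (tnth n i)); apply: An; rewrite mem_sort mem_tnth.
Qed.

Lemma ltn_path_sort l (n : l.-tuple nat) : uniq n ->
  (forall i, (1 <= tnth n i)%N) -> path ltn 0 (sort leq n).
Proof.
move=> un n1; rewrite path_min_sorted; last first.
  by apply/allP => m; rewrite mem_sort => /tnthP[i ->]; exact: n1.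
by rewrite ltn_sorted_uniq_leq sort_uniq un (sort_sorted leq_total).
Qed.

Lemma visits_gt k n : 0 < pr A ->
  (forall m C, (0 < m)%N -> measurable C -> C `<=` A -> 0 < pr C ->
    pr A * pr C < pr (A `&` iter m T @^-1` C)) ->
  path ltn k n -> (0 < size n)%N -> pr A ^+ (size n).+1 < pr (visits k n).
Proof.
move=> A0 over; elim: n k => [//|m n IHn] k /= /andP[km pn] _.
(* Only a weak inequality: with no later visit both sides equal [pr A]. The strictness comes from
   the visit being added. *)
have le_n : pr A ^+ (size n).+1 <= pr (visits m n).
  by case: n pn IHn => [|i n] pn IHn; [rewrite expr1|exact/ltW/IHn].
have n0 : 0 < pr (visits m n) by apply: lt_le_trans le_n; exact: exprn_gt0.
rewrite exprS; apply: (@le_lt_trans _ _ (pr A * pr (visits m n))).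
  by rewrite ler_pM2l.
apply: over => //; [by rewrite subn_gt0|exact: measurable_visits|exact: visits_sub].
Qed.

Lemma visits_lt k n : 0 < pr A ->
  (forall m C, (0 < m)%N -> measurable C -> C `<=` A -> 0 < pr C ->
    pr (A `&` iter m T @^-1` C) < pr A * pr C) ->
  path ltn k n -> (0 < size n)%N -> pr (visits k n) < pr A ^+ (size n).+1.
Proof.
move=> A0 under_; elim: n k => [//|m n IHn] k /= /andP[km pn] _.
have le_n : pr (visits m n) <= pr A ^+ (size n).+1.
  by case: n pn IHn => [|i n] pn IHn; [rewrite expr1|exact/ltW/IHn].
have mV := measurable_visits m n.
have mV' : measurable (iter (m - k) T @^-1` visits m n).
  by rewrite -[X in measurable X]setTI; exact: measurable_iter.
have [n0|n0] := ltP 0 (pr (visits m n)).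
  rewrite exprS; apply: (@lt_le_trans _ _ (pr A * pr (visits m n))).
    by apply: under_ => //; [rewrite subn_gt0|exact: visits_sub].
  by rewrite ler_pM2l.
(* If the later visits form a null set, [under_] does not apply, but by invariance the whole event
   is null too, hence below the positive power. *)
apply: (@le_lt_trans _ _ (pr (visits m n))).
  rewrite -[leRHS](_ : pr (iter (m - k) T @^-1` visits m n) = _).
    by rewrite fine_le ?fin_num_measure // ?le_measure ?inE //; exact: measurableI.
  by rewrite /pr (preserving_iter mT presT).
by apply: (le_lt_trans n0); exact: exprn_gt0.
Qed.

End successive_visits.

(** Uniqueness of Lebesgue measure: a times the image measure gives every interval ]u, v] its
    length. *)
Lemma lebesgue_measure_affine (R : realType) (a b : R) (E : set R) : 0 < a ->
  measurable E ->
  lebesgue_measure ((fun x => a * x + b) @^-1` E) = (a^-1%:E * lebesgue_measure E)%E.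
Proof.
move=> a0 mE; have a00 := ltW a0.
have mf : measurable_fun setT ((fun x => a * x + b) : R -> measurableTypeR R).
  by apply: measurable_funD => //; exact: measurable_funM.
rewrite (@lebesgue_measure_unique _
  (mscale (NngNum a00) (pushforward lebesgue_measure
    ((fun x => a * x + b) : R -> measurableTypeR R))) _ E mE).
  by rewrite /mscale /= muleA -EFinM mulVf ?mul1e // gt_eqF.
move=> _ [[u v] _ <-].
pose I : set R := `](u - b) / a, (v - b) / a]%classic.
transitivity (a%:E * lebesgue_measure I)%E; last first.
  rewrite /mscale /= /pushforward; congr (_ * lebesgue_measure _)%E.
  apply/seteqP; split => x; rewrite /I /= !in_itv /= ltr_pdivrMr // ler_pdivlMr //;
    by rewrite ltrBlDr lerBrDr mulrC.
rewrite /I !lebesgue_measure_itv /= !lte_fin ltr_pM2r ?invr_gt0 // ltrD2r.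
case: ifP => _; last by rewrite mule0.
by rewrite -!EFinD -EFinM; congr EFin; field; rewrite gt_eqF.
Qed.

(** * The map 3x mod 1 on ]0, 1] *)

Section ternary_map.
Context (R : realType).
Local Notation X := (measurableTypeR R).

(** The space is the whole line, with a measure carried by ]0, 1]; this avoids a subtype. *)
Definition unit_lebesgue : set X -> \bar R :=
  mrestr (@lebesgue_measure R) (measurable_itv `]0%R, 1%R]).

HB.instance Definition _ := Measure.on unit_lebesgue.

Lemma unit_lebesgue_setT : unit_lebesgue setT = 1%E.
Proof.
by rewrite /unit_lebesgue /mrestr setTI lebesgue_measure_itv /= lte01 sube0.
Qed.

HB.instance Definition _ :=
  Measure_isProbability.Build _ _ _ unit_lebesgue unit_lebesgue_setT.

(* The digit intervals are left-open, so that [ternary_map] maps ]0, 1] to itself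
   and each of its three branches maps onto ]0, 1]. *)
Definition ternary_digit (x : X) : nat := ((3^-1 < x)%R + (2 / 3 < x)%R)%N.

Definition ternary_map (x : X) : X := 3 * x - (ternary_digit x)%:R.

Lemma ternary_digitE (x : X) :
  (ternary_digit x)%:R = \1_`]3^-1, +oo[ x + \1_`]2 / 3, +oo[ x :> R.
Proof.
rewrite /ternary_digit natrD !indicE.
congr (_%:R + _%:R); congr nat_of_bool;
  by apply/idP/idP; rewrite ?inE /= in_itv /= ?andbT.
Qed.

Lemma measurable_ternary_digitR : measurable_fun setT (fun x : X => (ternary_digit x)%:R : R).
Proof.
under eq_fun do rewrite ternary_digitE.
by apply: measurable_funD; exact: measurable_indic.
Qed.

Lemma measurable_ternary_digit i : measurable (ternary_digit @^-1` [set i]).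
Proof.
rewrite (_ : _ @^-1` _ = (fun x : X => (ternary_digit x)%:R : R) @^-1` [set i%:R]).
  by rewrite -[X in measurable X]setTI; exact: measurable_ternary_digitR.
by apply/seteqP; split=> x /= [/eqP]; rewrite ?eqr_nat => /eqP ->.
Qed.

Lemma measurable_ternary_map : measurable_fun setT ternary_map.
Proof.
apply: measurable_funB; last exact: measurable_ternary_digitR.
by apply: measurable_funM.
Qed.

Lemma ternary_digit_lt3 x : (ternary_digit x < 3)%N.
Proof. by rewrite /ternary_digit; do 2 case: (_ < _). Qed.

(** A point lies in ]0, 1] with digit i exactly when 3x - i lies in ]0, 1], so the set is an affine
    preimage of the part of C in ]0, 1]. *)
Lemma unit_lebesgue_branch i C : (i < 3)%N -> measurable C ->
  unit_lebesgue (ternary_digit @^-1` [set i] `&` ternary_map @^-1` C) =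
  (3^-1%:E * unit_lebesgue C)%E.
Proof.
move=> i3 mC; rewrite /unit_lebesgue /mrestr.
rewrite -(lebesgue_measure_affine (- i%:R)) //; last exact: measurableI.
congr lebesgue_measure; apply/seteqP; split => x /=; rewrite !in_itv /=.
  move=> [[<- Cx] /andP[x0 x1]]; split=> //; rewrite /ternary_digit.
  by case: (ltP 3^-1 x) => ?; case: (ltP (2 / 3) x) => ? /=; apply/andP; split; lra.
move=> [Cx /andP[x0 x1]]; have xi : ternary_digit x = i.
  move: i3 x0 x1; rewrite /ternary_digit; case: i {Cx} => [|[|[|//]]] _ /= x0 x1;
  by case: (ltP 3^-1 x) => ?; case: (ltP (2 / 3) x) => ? //=; exfalso; lra.
split; first by rewrite /ternary_map xi.
have i0 : 0 <= i%:R :> R by [].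
have i2 : i%:R <= 2 :> R by rewrite ler_nat -ltnS.
by apply/andP; split; lra.
Qed.

Lemma ternary_map_preserving A : measurable A ->
  unit_lebesgue (ternary_map @^-1` A) = unit_lebesgue A.
Proof.
exact: (ternary_preserving (P := unit_lebesgue) measurable_ternary_map
  measurable_ternary_digit ternary_digit_lt3 unit_lebesgue_branch).
Qed.

(** * Exponential decorrelation of rays, and multiple mixing *)

Local Notation ray a := (`]a, +oo[%classic : set X).

Lemma indic_norm_le1 (A : set X) x : `|\1_A x : R| <= 1.
Proof. by rewrite indicE ger0_norm ?ler0n // lern1 leq_b1. Qed.

(** On the branch with digit i, a < x means 3a - i < T x, and each branch carries a third of the
    integral. *)
Lemma Rintegral_ray_step a (H : X -> R) (K : R) : measurable_fun setT H ->
  (forall x, `|H x| <= K) ->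
  \int[unit_lebesgue]_x (\1_(ray a) x * H (ternary_map x)) =
  (\sum_(i < 3) \int[unit_lebesgue]_x (\1_(ray (3 * a - i%:R)) x * H x)) / 3.
Proof.
move=> mH bH.
pose D i := ternary_digit @^-1` [set i].
pose F (i : nat) (x : X) : R := \1_(ray (3 * a - i%:R)) x * H x.
have mF i : measurable_fun setT (F i).
  by apply: measurable_funM => //; exact: measurable_indic.
have bF i x : `|F i x| <= K.
  by rewrite normrM -[leRHS]mul1r ler_pM // indic_norm_le1.
have mDF i : measurable_fun setT (fun x => \1_(D i) x * F i (ternary_map x)).
  apply: measurable_funM; first by apply: measurable_indic; exact: measurable_ternary_digit.
  exact: (measurableT_comp (mF i) measurable_ternary_map).
have iF i : unit_lebesgue.-integrable setT
    (EFin \o (fun x => \1_(D i) x * F i (ternary_map x))).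
  apply: (@bounded_integrable _ _ _ _ _ K) => // x.
  by rewrite normrM -[leRHS]mul1r ler_pM // indic_norm_le1.
rewrite (@eq_Rintegral _ _ _ _ _ (fun x => \1_(D 0) x * F 0 (ternary_map x) +
   (\1_(D 1) x * F 1 (ternary_map x) + \1_(D 2) x * F 2 (ternary_map x)))).
  rewrite RintegralD //; last exact: integrableD (iF 1) (iF 2).
  rewrite RintegralD // !(Rintegral_branch measurable_ternary_map measurable_ternary_digit
    unit_lebesgue_branch _ (mF _) (bF _)) //.
  by rewrite !big_ord_recl big_ord0 addr0 -!mulrDl.
move=> x _; rewrite !indicE /F /D.
have dE i : (x \in ternary_digit @^-1` [set i]) = (ternary_digit x == i).
  by apply/idP/eqP; rewrite inE.
have rE b y : (y \in ray b) = (b < y).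
  by apply/idP/idP; rewrite inE /= in_itv /= andbT.
rewrite !dE !indicE !rE.
have -> : (a < x) = (3 * a - (ternary_digit x)%:R < ternary_map x).
  by rewrite /ternary_map ltrD2r ltr_pM2l.
case: (ternary_digit x) (ternary_digit_lt3 x) => [|[|[|//]]] _ /=;
  by rewrite !mul0r !mul1r ?addr0 ?add0r.
Qed.

Lemma corr_ray_step a (G : X -> R) (K : R) n : measurable_fun setT G ->
  (forall x, `|G x| <= K) ->
  corr unit_lebesgue ternary_map (\1_(ray a)) G n.+1 =
  (\sum_(i < 3) corr unit_lebesgue ternary_map (\1_(ray (3 * a - i%:R))) G n) / 3.
Proof.
move=> mG bG; rewrite /corr sumrB -mulr_suml mulrBl.
congr (_ - _).
  rewrite -(@Rintegral_ray_step a (fun x => G (iter n ternary_map x)) K) //.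
    by apply: eq_Rintegral => x _; rewrite iterSr.
  exact: (measurable_comp_iter measurable_ternary_map).
rewrite mulrAC; congr (_ * _).
under eq_Rintegral do rewrite -[\1__ _]mulr1.
(* The same identity with H = 1 splits the mean of the ray. *)
rewrite (@Rintegral_ray_step a (cst 1) 1) //; last by move=> x; rewrite normr1.
congr (_ / _); apply: eq_bigr => i _.
by apply: eq_Rintegral => x _; rewrite mulr1.
Qed.

Lemma ae_unit_itv : {ae unit_lebesgue, forall x : X, 0 < x <= 1}.
Proof.
exists (~` `]0, 1]); split; first exact: measurableC.
  by rewrite /unit_lebesgue /mrestr setICl measure0.
by move=> x /= nx; rewrite /= in_itv.
Qed.

(** Such a ray contains or misses ]0, 1], so its indicator is almost everywhere constant, and
    constants have zero correlation by invariance. *)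
Lemma corr_ray0 a (G : X -> R) (K : R) n : measurable_fun setT G ->
  (forall x, `|G x| <= K) -> (a <= 0) || (1 <= a) ->
  corr unit_lebesgue ternary_map (\1_(ray a)) G n = 0.
Proof.
move=> mG bG a01.
have mGn : measurable_fun setT (fun x => G (iter n ternary_map x)).
  exact: (measurable_comp_iter measurable_ternary_map).
have [c ac] : exists c : R, {ae unit_lebesgue, forall x, \1_(ray a) x = c}.
  have rE y : (y \in ray a) = (a < y).
    by apply/idP/idP; rewrite inE /= in_itv /= andbT.
  exists (a <= 0)%R%:R; apply: filterS ae_unit_itv => x /andP[x0 x1].
  rewrite indicE rE; congr (nat_of_bool _)%:R.
  case/orP : a01 => [a0|a1]; first by rewrite a0 (le_lt_trans a0 x0).
  by rewrite ltNge (le_trans x1 a1) leNgt (lt_le_trans ltr01 a1).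
have mI : measurable_fun setT (\1_(ray a) : X -> R) by exact: measurable_indic.
rewrite /corr.
rewrite (@eq_ae_Rintegral _ _ _ _ _ (fun x => c * G (iter n ternary_map x))); first last.
- by apply: filterS ac => x ->.
- exact: measurable_funM.
- exact: measurable_funM.
rewrite (@eq_ae_Rintegral _ _ _ unit_lebesgue (\1_(ray a)) (cst c)) //.
rewrite RintegralZl //; last exact: (@bounded_integrable _ _ _ _ _ K).
rewrite (Rintegral_iter measurable_ternary_map ternary_map_preserving _ mG bG).
rewrite Rintegral_cst // (_ : fine _ = 1) ?mulr1 ?subrr //.
exact: (congr1 fine unit_lebesgue_setT).
Qed.

(* Of the three rays in [corr_ray_step], at most one starts inside the unit
   interval, so the correlation contracts by a factor 3 at each step. *)
Lemma corr_ray a (G : X -> R) (K : R) n : measurable_fun setT G ->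
  (forall x, `|G x| <= K) ->
  `|corr unit_lebesgue ternary_map (\1_(ray a)) G n| <= 2 * K / 3 ^+ n.
Proof.
move=> mG bG; elim: n a => [|n IHn] a.
  rewrite expr0 divr1 mulr_natl mulr2n /corr /=.
  have I1 := indic_norm_le1 (ray a).
  have mI : measurable_fun setT (\1_(ray a) : X -> R) by exact: measurable_indic.
  apply: (le_trans (ler_normB _ _)); apply: lerD.
    apply: le_Rintegral_norm; first exact: measurable_funM.
    by move=> x; rewrite normrM -[leRHS]mul1r ler_pM.
  rewrite normrM -[leRHS]mul1r ler_pM //.
    exact: (le_Rintegral_norm unit_lebesgue mI I1).
  exact: le_Rintegral_norm.
rewrite (corr_ray_step _ _ mG bG) normrM exprSr invfM mulrA.
rewrite (ger0_norm (x := 3^-1)) // ler_wpM2r //.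
pose c (i : nat) := corr unit_lebesgue ternary_map (\1_(ray (3 * a - i%:R))) G n.
rewrite (_ : \sum_(i < 3) _ = c 0 + (c 1 + c 2)); last first.
  by rewrite !big_ord_recl big_ord0 addr0.
have c0 i : (3 * a - i%:R <= 0) || (1 <= 3 * a - i%:R) -> c i = 0.
  exact: corr_ray0 mG bG.
have [a1|a1] := leP a 3^-1.
  rewrite [c 1]c0 ?[c 2]c0 ?addr0; [exact: IHn|apply/orP; left; lra..].
have [a2|a2] := leP a (2 / 3).
  rewrite [c 0]c0; last by apply/orP; right; lra.
  rewrite [c 2]c0; last by apply/orP; left; lra.
  by rewrite add0r addr0; exact: IHn.
rewrite [c 0]c0 ?[c 1]c0 ?add0r; [exact: IHn|apply/orP; right; lra..].
Qed.

(** The rays are closed under intersection and generate the Borel sets, so their decay extends to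
    all integrable functions. *)
Lemma decorrelates_unit_lebesgue (f : X -> R) :
  unit_lebesgue.-integrable setT (EFin \o f) ->
  decorrelates unit_lebesgue ternary_map f.
Proof.
apply: decorrelates_integrable.
- exact: measurable_ternary_map.
- exact: ternary_map_preserving.
apply: (decorrelates_indic measurable_ternary_map ternary_map_preserving).
- exact: RGenOInfty.measurableE.
- move=> _ _ [a ->] [b ->]; exists (Num.max a b).
  by apply/seteqP; split=> x /=; rewrite !in_itv /= !andbT gt_max => /andP.
(* This threshold gives 2 / e < n + 1 by truncation and in fact 2 / e <= n <= 3 ^ n, which turns the
   rate 2 / 3 ^ n into e. *)
- move=> _ [a ->] e e0; exists (Num.truncn (2 / e)).+1 => n ne G K mG bG.
  have K0 : 0 <= K by apply: le_trans (bG point); exact: normr_ge0.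
  apply: (le_trans (corr_ray a n mG bG)); rewrite mulrAC ler_wpM2r //.
  rewrite ler_pdivrMr ?exprn_gt0 // mulrC -ler_pdivrMr //.
  apply: (le_trans (ltW (truncnS_gt _))); rewrite -natrX ler_nat.
  by apply: (leq_trans ne); exact/ltnW/ltn_expl.
Qed.

Lemma ternary_map_multiple_mixing :
  multiple_mixing (unit_lebesgue : probability X R) ternary_map.
Proof.
apply: decorrelates_multiple_mixing.
- exact: measurable_ternary_map.
- exact: ternary_map_preserving.
- exact: decorrelates_unit_lebesgue.
Qed.

End ternary_map.

(** * Under-recurrence and over-recurrence for the ternary map *)

Local Open Scope ereal_scope.

Theorem theorem2p3 (R : realType) :
  (forall d : nat, (1 <= d)%N ->
    exists (disp : measure_display) (X : measurableType disp)
           (mu : probability X R) (T : X -> X) (A : set X),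
      [/\ measure_preserving mu T,
          multiple_mixing mu T,
          measurable A,
          0 < mu A < 1 &
          forall (l : nat) (n : l.-tuple nat),
            (1 <= l <= d)%N -> uniq n -> (forall i, (1 <= tnth n i)%N) ->
            mu (A `&` \bigcap_(i in [set: 'I_l]) (iter (tnth n i) T @^-1` A))
              < mu A ^+ l.+1])
  /\
  (forall d : nat, (1 <= d)%N ->
    exists (disp : measure_display) (X : measurableType disp)
           (mu : probability X R) (T : X -> X) (A : set X),
      [/\ measure_preserving mu T,
          multiple_mixing mu T,
          measurable A,
          0 < mu A < 1 &
          forall (l : nat) (n : l.-tuple nat),
            (1 <= l <= d)%N -> uniq n -> (forall i, (1 <= tnth n i)%N) ->
            mu A ^+ l.+1
              < mu (A `&` \bigcap_(i in [set: 'I_l]) (iter (tnth n i) T @^-1` A))]).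
Proof.
pose T := @ternary_map R.
have mT : measurable_fun setT T := @measurable_ternary_map R.
have mD := @measurable_ternary_digit R.
have branchP := @unit_lebesgue_branch R.
have ltD := @ternary_digit_lt3 R.
have presT := @ternary_map_preserving R.
have mF := measurable_first_nonzero mT mD.
pose P : probability (measurableTypeR R) R := @unit_lebesgue R.
have PE (B : set (measurableTypeR R)) : measurable B -> P B = (fine (P B))%:E.
  by move=> mB; rewrite fineK // fin_num_measure.
split=> d _.
- pose A := isolated_one T (@ternary_digit R).
  have mA : measurable A := measurable_isolated_one mT mD.
  have pA : fine (P A) = (6^-1)%R := pr_isolated_one mT mD branchP.
  exists _, (measurableTypeR R), P, T, A; split => //.
  + exact: ternary_map_multiple_mixing.
  + by rewrite PE // pA !lte_fin invr_gt0 invf_lt1 ?ltr1n ltr0n.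
  + move=> l n /andP[l1 _] un n1.
    rewrite visits_bigcap (PE A) // (PE (visits _ _ _ _)); last first.
      exact: (measurable_visits mT mA).
    rewrite -EFin_expe lte_fin -{2}(size_tuple n) -(size_sort leq).
    apply: (visits_lt mT mA presT).
    * by rewrite pA; lra.
    * move=> m C m0 mC CA C0; exact: (isolated_one_under mT mD ltD branchP mC CA C0 m0).
    * exact: ltn_path_sort.
    * by rewrite size_sort size_tuple.
- pose A := first_nonzero T (@ternary_digit R) 1.
  have mA : measurable A := mF 1%N.
  have pA : fine (P A) = (2^-1)%R by exact: (pr_first_nonzero mT mD branchP).
  exists _, (measurableTypeR R), P, T, A; split => //.
  + exact: ternary_map_multiple_mixing.
  + by rewrite PE // pA !lte_fin invr_gt0 invf_lt1 ?ltr1n ltr0n.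
  + move=> l n /andP[l1 _] un n1.
    rewrite visits_bigcap (PE A) // (PE (visits _ _ _ _)); last first.
      exact: (measurable_visits mT mA).
    rewrite -EFin_expe lte_fin -{1}(size_tuple n) -(size_sort leq).
    apply: (visits_gt mT mA).
    * by rewrite pA; lra.
    * move=> m C m0 mC CA C0; exact: (first_nonzero_over mT mD ltD branchP _ mC CA C0).
    * exact: ltn_path_sort.
    * by rewrite size_sort size_tuple.
Qed.
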